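(* Let $N$ be a positive integer and let $c_{ij}=g_{ij}/h_{ij}$ ($1\le i\le I$, $1\le j\le J$) be given conditional frequencies with $g_{ij}\ge 0$, $h_{ij}\ge 1$ relatively prime integers and $\sum_i c_{ij}=1$ for each $j$; let $m_j$ be the least common multiple of $h_{1j},\dots,h_{Ij}$. Let $(x^{(l)}_1,\dots,x^{(l)}_J)$, $l=1,\dots,m$, be the positive integer solutions of $\sum_{j=1}^J m_jx_j=N$, and let $\mathfrak p_l$ be the $[AB]$ marginal table with entries $s^{(l)}_{ij+}=m_jx^{(l)}_jc_{ij}$. Then the number of $r$-way tables given the observed conditionals $[A|B]$ (and grand total $N$) is $$|\mathcal F_{A|B}|=\sum_{l=1}^m|\mathcal F_{AB}(\mathfrak p_l)|,\qquad\text{where}\qquad |\mathcal F_{AB}(\mathfrak p_l)|=\prod_{1\le i\le I,\,1\le j\le J}\binom{s^{(l)}_{ij+}+K-1}{K-1}.$$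
   Context: Let $X_1,\dots,X_r$ be categorical variables with finitely many levels each. Let $A,B$ be disjoint proper subsets of $\{X_1,\dots,X_r\}$ and let $C$ be the set of the remaining variables (possibly empty). Regard $A,B,C$ as three compound categorical variables with $I$, $J$, $K$ levels respectively ($K=1$ if $C=\emptyset$). An $r$-way contingency table is identified with a 3-way array $(s_{ijk})$ of nonnegative integers, $1\le i\le I$, $1\le j\le J$, $1\le k\le K$. A subscript $+$ denotes summation over that index. $\mathcal F_{A|B}$ is the set of all tables $(s_{ijk})$ of nonnegative integers with $\sum_{i,j,k}s_{ijk}=N$, $s_{+j+}>0$ for all $j$, and $s_{ij+}/s_{+j+}=c_{ij}$ for all $i,j$. For a nonnegative integer $I\times J$ array $\mathfrak p=(p_{ij})$, $\mathcal F_{AB}(\mathfrak p)$ is the set of all tables $(s_{ijk})$ of nonnegative integers with $s_{ij+}=p_{ij}$ for all $i,j$. *)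

(* Defs.v *)
From mathcomp Require Import all_boot all_order all_algebra.
From mathcomp Require Import finmap.
From mathcomp Require Import boolp classical_sets cardinality fsbigop.

Set Implicit Arguments.
Unset Strict Implicit.
Unset Printing Implicit Defensive.

(* The r variables are indexed by 'I_r; variable v has n v levels. *)

Definition cell (r : nat) (n : 'I_r -> nat) : finType :=
  {dffun forall v : 'I_r, 'I_(n v)}.

(* Levels of the compound variable formed by the variables in S
   (exactly one level when S is empty). *)
Definition level (r : nat) (n : 'I_r -> nat) (S : {set 'I_r}) : finType :=
  {dffun forall v : {v : 'I_r | v \in S}, 'I_(n (val v))}.

Definition table (r : nat) (n : 'I_r -> nat) : choiceType :=
  {ffun cell n -> nat}.

Definition rest (r : nat) (A B : {set 'I_r}) : {set 'I_r} := ~: (A :|: B).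

Lemma mem_rest (r : nat) (A B : {set 'I_r}) (v : 'I_r) :
  v \notin A -> v \notin B -> v \in rest A B.
Proof. by move=> vA vB; rewrite !inE negb_or vA vB. Qed.

Section ThreeWay.
Variables (r : nat) (n : 'I_r -> nat) (A B : {set 'I_r}).

Local Notation LA := (level n A).
Local Notation LB := (level n B).
Local Notation LC := (level n (rest A B)).

(* The cell with A-part i, B-part j and C-part k.  For disjoint A and B this
   is a bijection from LA * LB * LC to the cells: it identifies an r-way table
   with a 3-way array. *)
Definition glue_at (i : LA) (j : LB) (k : LC) (v : 'I_r) : 'I_(n v) :=
  match boolP (v \in A), boolP (v \in B) with
  | AltTrue vA, _ => i (exist _ v vA)
  | AltFalse _, AltTrue vB => j (exist _ v vB)
  | AltFalse vA, AltFalse vB => k (exist _ v (mem_rest vA vB))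
  end.

Definition glue (i : LA) (j : LB) (k : LC) : cell n :=
  [ffun v => glue_at i j k v].

Definition entry (s : table n) (i : LA) (j : LB) (k : LC) : nat :=
  s (glue i j k).

(* s_{ij+}, s_{+j+} and s_{+++} *)
Definition margAB (s : table n) (i : LA) (j : LB) : nat :=
  \sum_(k : LC) entry s i j k.

Definition margB (s : table n) (j : LB) : nat :=
  \sum_(i : LA) \sum_(k : LC) entry s i j k.

Definition total (s : table n) : nat :=
  \sum_(i : LA) \sum_(j : LB) \sum_(k : LC) entry s i j k.

Definition F_cond (N : nat) (c : LA -> LB -> rat) : set (table n) :=
  [set s | [/\ total s = N,
               forall j, 0 < margB s j &
               forall i j,
                 ((margAB s i j)%:R / (margB s j)%:R)%R = c i j]]%classic.

Definition F_marg (p : LA -> LB -> nat) : set (table n) :=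
  [set s | forall i j, margAB s i j = p i j]%classic.

Definition possols (m : LB -> nat) (N : nat) : set {ffun LB -> nat} :=
  [set x | (forall j, 0 < x j) /\ \sum_(j : LB) m j * x j = N]%classic.

(* The table m_j x_j c_ij; Num.truncn reads the value as a natural number,
   which loses nothing only when the value is one. *)
Definition sol_margin (m : LB -> nat) (c : LA -> LB -> rat)
    (x : {ffun LB -> nat}) (i : LA) (j : LB) : nat :=
  Num.truncn ((m j)%:R * (x j)%:R * c i j)%R.

End ThreeWay.

(* Number of elements of a finite set (0 if A is infinite). *)
Definition ncard (T : choiceType) (A : set T) : nat := #|` fset_set A|%fset.

(* Main.v *)
Require Import Defs.
From mathcomp Require Import all_boot all_order all_algebra.
From mathcomp Require Import finmap.
From mathcomp Require Import boolp classical_sets cardinality fsbigop.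
From mathcomp Require Import ring.

(** Why the formula holds.

    Let s be a table with the prescribed conditionals, so that
    h_ij s_{ij+} = g_ij s_{+j+}.  As g_ij and h_ij are coprime, h_ij divides
    s_{+j+} for every i, hence so does their least common multiple m_j
    ([F_cond_dvd]).  The numbers x_j = s_{+j+} / m_j are therefore positive
    integers with sum_j m_j x_j = N: each such s singles out one solution x
    ([solution_of], [solution_of_possols]), and then s_{ij+} = m_j x_j c_ij.
    Conversely, m_j x_j c_ij is a natural number because h_ij divides m_j
    ([sol_marginE]); since sum_i c_ij = 1, a table with these [AB] margins has
    s_{+j+} = m_j x_j, so it has the prescribed conditionals and singles out
    x again.  The tables over x are thus exactly those with the margin of x
    ([F_cond_fiber]), and counting fibre by fibre ([ncard_fibers]) gives the
    sum.

    For one margin p, gluing levels is a bijection from triples (i, j, k) to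
    cells, so a table with margin p is an independent choice, for each (i, j),
    of K natural numbers of sum p_ij ([F_marg_range]).  Stars and bars counts
    each choice ([card_composition]), whence the product of binomials. *)

Set Implicit Arguments.
Unset Strict Implicit.
Unset Printing Implicit Defensive.

Import GRing.Theory Num.Theory.

(** * Counting finite sets *)

Lemma finite_bounded_ffun (T : finType) (M : nat) (A : set {ffun T -> nat}) :
  (forall f, A f -> forall x, f x <= M) -> finite_set A.
Proof.
move=> leM; pose w (f : {ffun T -> 'I_M.+1}) : {ffun T -> nat} :=
  [ffun x => f x : nat].
apply: (@sub_finite_set _ _ (w @` setT)%classic); last first.
  exact/finite_image/finite_finset.
move=> f /leM fM; exists [ffun x => inord (f x)] => //.
by apply/ffunP=> x; rewrite !ffunE inordK // ltnS.
Qed.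

Lemma ncard_range (S : finType) (T : choiceType) (phi : S -> T) :
  injective phi -> ncard (range phi) = #|S|.
Proof.
move=> inj; rewrite /ncard cardE -(size_map phi); apply/perm_size/uniq_perm.
- exact: fset_uniq.
- by rewrite map_inj_uniq // enum_uniq.
- move=> y; rewrite in_fset_set; last exact/finite_image/finite_finset.
  apply/idP/mapP => [/set_mem[x _ <-]|[x _ ->]].
    by exists x => //; rewrite mem_enum.
  by apply: mem_set; exists x.
Qed.

(** Double counting of the pairs (s, x) with f s = x: an element s of F lies in
    exactly one fibre. *)
Lemma ncard_fibers (T I : choiceType) (F : set T) (D : set I) (f : T -> I) :
  finite_set F -> finite_set D -> (forall s, F s -> D (f s)) ->
  ncard F = \big[addn/0]_(x \in D) ncard [set s | F s /\ f s = x]%classic.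
Proof.
move=> finF finD FD; rewrite fsbig_finite //= /ncard -sum1_size.
rewrite (eq_big_seq (fun s => \sum_(x <- fset_set D | f s == x) 1)); last first.
  move=> s; rewrite in_fset_set // => /set_mem/FD Dfs.
  rewrite sum1_count (eq_count (a2 := pred1 (f s))) => [|x /=]; last first.
    by rewrite eq_sym.
  by rewrite count_uniq_mem ?fset_uniq // in_fset_set // mem_set.
rewrite (exchange_big_dep xpredT) //=; apply: eq_bigr => x _.
rewrite sum1_count -size_filter.
apply/perm_size/uniq_perm; rewrite ?filter_uniq ?fset_uniq // => s.
have finFx : finite_set [set s | F s /\ f s = x]%classic.
  by apply: sub_finite_set finF => t [].
rewrite mem_filter !in_fset_set //.
by apply/andP/idP => [[/eqP fx /set_mem Fs]|/set_mem[Fs ->]];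
  [apply: mem_set | split => //; apply: mem_set].
Qed.

(** * Stars and bars *)

(** The weak compositions of N with parts indexed by T.  The parts cannot
    exceed N, which is what makes this a finite type. *)
Definition composition (T : finType) (N : nat) : finType :=
  {f : {ffun T -> 'I_N.+1} | \sum_x f x == N :> nat}.

Lemma card_composition (T : finType) (N : nat) :
  0 < #|T| -> #|composition T N| = 'C(N + #|T| - 1, #|T| - 1).
Proof.
move=> T_gt0; have card_tuples k : 0 < k ->
    #|[set t : k.-tuple 'I_N.+1 | \sum_(i <- t) i == N]| = 'C(N + k - 1, k - 1).
  by case: k => // k _; rewrite card_ord_partitions addnS !subn1 addnC.
(* Functions on T and #|T|-tuples correspond through their graphs. *)
rewrite -card_tuples // card_sig -(@on_card_preimset _ _ (@fgraph T 'I_N.+1)).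
  apply: eq_card => f; rewrite !inE.
  by congr (_ == N); rewrite big_image.
by apply/onW_bij; exists (fun t => Finfun t); [exact: fgraphK | exact: FinfunK].
Qed.

(** * Cells as triples of levels *)

Section ThreeWay.
Variables (r : nat) (n : 'I_r -> nat) (A B : {set 'I_r}).

Definition part (S : {set 'I_r}) (w : cell n) : level n S :=
  [ffun v => w (val v)].

Lemma level_gt0 (S : {set 'I_r}) : (forall v, 0 < n v) -> 0 < #|level n S|.
Proof.
move=> n_gt0; apply/card_gt0P.
by exists [ffun v : {v : 'I_r | v \in S} => Ordinal (n_gt0 (val v))].
Qed.

Lemma glue_partK (w : cell n) :
  glue (part A w) (part B w) (part (rest A B) w) = w.
Proof.
apply/ffunP=> v; rewrite ffunE /glue_at.
(* The index of boolP (v \in A) must not be abstracted when splitting on it: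
   the type of the proof carried by each branch mentions the same boolean. *)
case: {-}(v \in A) / (boolP (v \in A)) => vA; first by rewrite ffunE.
by case: {-}(v \in B) / (boolP (v \in B)) => vB; rewrite ffunE.
Qed.

Hypothesis AB_disjoint : [disjoint A & B].

Section Glue.
Variables (i : level n A) (j : level n B) (k : level n (rest A B)).

Lemma part_glueA : part A (glue i j k) = i.
Proof.
apply/ffunP=> -[v vA]; rewrite !ffunE /glue_at /=.
case: {-}(v \in A) / (boolP (v \in A)) => [vA'|/negP//].
by rewrite (bool_irrelevance vA' vA).
Qed.

(** Disjointness matters here: on a common variable, [glue] reads the A-level
    only. *)
Lemma part_glueB : part B (glue i j k) = j.
Proof.
apply/ffunP=> -[v vB]; rewrite !ffunE /glue_at /=.
case: {-}(v \in A) / (boolP (v \in A)) => [vA|vA].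
  by have := disjointFr AB_disjoint vA; rewrite vB.
case: {-}(v \in B) / (boolP (v \in B)) => [vB'|/negP//].
by rewrite (bool_irrelevance vB' vB).
Qed.

Lemma part_glueC : part (rest A B) (glue i j k) = k.
Proof.
apply/ffunP=> -[v vC]; rewrite !ffunE /glue_at /=.
have /norP[vA vB] : ~~ ((v \in A) || (v \in B)) by rewrite !inE in vC.
case: {-}(v \in A) / (boolP (v \in A)) => [vA'|vA'].
  by case/negP: vA.
case: {-}(v \in B) / (boolP (v \in B)) => [vB'|vB'].
  by case/negP: vB.
by congr (k (exist _ v _)); apply: bool_irrelevance.
Qed.

End Glue.

(** * Tables with a given [AB] margin *)

(** A table with [AB] margin p is a family of compositions, one for each level
    pair (i, j): its row k |-> s_ijk is an arbitrary composition of p_ij. *)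
Lemma F_marg_range (p : level n A -> level n B -> nat) :
  exists2 phi : {dffun forall q : level n A * level n B,
                   composition (level n (rest A B)) (p q.1 q.2)} -> table n,
    injective phi & F_marg p = range phi.
Proof.
pose phi (f : {dffun forall q : level n A * level n B,
                   composition (level n (rest A B)) (p q.1 q.2)}) : table n :=
  [ffun w => val (f (part A w, part B w)) (part (rest A B) w) : nat].
have phi_entry f i j k : entry (phi f) i j k = val (f (i, j)) k.
  by rewrite /entry ffunE part_glueA part_glueB part_glueC.
exists phi.
  move=> f f' ff'; apply/ffunP=> -[i j]; apply/val_inj/ffunP=> k.
  by apply/val_inj; rewrite /= -!phi_entry ff'.
apply/seteqP; split=> [s sp|_ [f _ <-] i j]; last first.
  rewrite -(eqP (valP (f (i, j)))).
  by apply: eq_bigr => k _; rewrite phi_entry.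
have le_sp i j k : entry s i j k <= p i j.
  by rewrite -sp /margAB (bigD1 k) ?leq_addr.
pose h q : {ffun level n (rest A B) -> 'I_(p q.1 q.2).+1} :=
  [ffun k => inord (entry s q.1 q.2 k)].
have hE q k : h q k = entry s q.1 q.2 k :> nat by rewrite ffunE inordK ?ltnS.
have hP q : \sum_k h q k == p q.1 q.2 :> nat.
  by apply/eqP; rewrite -[RHS]sp; apply: eq_bigr => k _.
exists [ffun q => exist _ (h q) (hP q)] => //.
by apply/ffunP=> w; rewrite ffunE [X in val X]ffunE [LHS]hE /entry glue_partK.
Qed.

Lemma finite_F_marg (p : level n A -> level n B -> nat) :
  finite_set (F_marg p).
Proof.
by have [phi _ ->] := F_marg_range p; apply/finite_image/finite_finset.
Qed.

Lemma ncard_F_marg (p : level n A -> level n B -> nat) :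
  let K := #|level n (rest A B)| in
  0 < K -> ncard (F_marg p) = \prod_i \prod_j 'C(p i j + K - 1, K - 1).
Proof.
move=> K K_gt0; have [phi phi_inj ->] := F_marg_range p.
rewrite ncard_range // card_dep_ffun foldrE big_map big_enum pair_big /=.
by apply: eq_bigr => q _; rewrite card_composition.
Qed.

End ThreeWay.

(** * Tables with given conditionals *)

Section Conditionals.
Variables (r : nat) (n : 'I_r -> nat) (A B : {set 'I_r}) (N : nat).
Variables (g h : level n A -> level n B -> nat).
Variables (c : level n A -> level n B -> rat) (m : level n B -> nat).

(** For each j, the multiplier x_j with s_{+j+} = m_j x_j; this equation holds
    for tables with conditionals c, where the division is exact. *)
Definition solution_of (s : table n) : {ffun level n B -> nat} :=
  [ffun j => margB A s j %/ m j].

Lemma total_margB (s : table n) :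
  Defs.total A B s = \sum_(j : level n B) margB A s j.
Proof. exact: exchange_big. Qed.

Lemma finite_F_cond : finite_set (F_cond N c).
Proof.
apply: (@finite_bounded_ffun _ N) => s [<- _ _] w.
rewrite -{1}(glue_partK A B w) /Defs.total (bigD1 (part A w)) //=.
rewrite (bigD1 (part B w)) //= (bigD1 (part (rest A B) w)) //=.
by rewrite -!addnA leq_addr.
Qed.

Hypothesis h_gt0 : forall i j, 0 < h i j.
Hypothesis m_def : forall j, m j = \big[lcmn/1]_(i : level n A) h i j.

Lemma m_gt0 j : 0 < m j.
Proof.
by rewrite m_def; elim/big_ind: _ => // x y x0 y0; rewrite lcmn_gt0 x0.
Qed.

Lemma finite_possols : finite_set (possols m N).
Proof.
apply: (@finite_bounded_ffun _ N) => x [_ <-] j.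
by rewrite (bigD1 j) //= (leq_trans _ (leq_addr _ _)) // leq_pmull ?m_gt0.
Qed.

Hypothesis c_def : forall i j, c i j = ((g i j)%:R / (h i j)%:R)%R.

(** Writing m_j = q h_ij, the rational m_j x_j c_ij is the natural number
    q x_j g_ij. *)
Lemma sol_marginE x i j :
  ((sol_margin m c x i j)%:R = (m j)%:R * (x j)%:R * c i j :> rat)%R.
Proof.
have /dvdnP[q mq] : h i j %| m j by rewrite m_def (biglcmn_sup i).
rewrite /sol_margin.
suff -> : ((m j)%:R * (x j)%:R * c i j = (q * x j * g i j)%:R :> rat)%R.
  by rewrite natrK.
have h0 : ((h i j)%:R != 0 :> rat)%R by rewrite pnatr_eq0 -lt0n.
by rewrite c_def mq !natrM; field.
Qed.

Hypothesis gh_coprime : forall i j, coprime (g i j) (h i j).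

(** From h_ij s_{ij+} = g_ij s_{+j+}, Gauss's lemma removes the factor
    g_ij. *)
Lemma F_cond_dvd s j : F_cond N c s -> m j %| margB A s j.
Proof.
move=> [_ s_gt0 sc]; rewrite m_def; apply/dvdn_biglcmP => i _.
have /eqP := sc i j; rewrite c_def eqr_div ?pnatr_eq0 -?lt0n //.
rewrite -!natrM eqr_nat => /eqP E.
by rewrite -(Gauss_dvdr _ (n := g i j)) 1?coprime_sym // -E dvdn_mull.
Qed.

Lemma solution_of_possols s :
  0 < N -> F_cond N c s -> possols m N (solution_of s).
Proof.
move=> N_gt0 Fs; have mB j := F_cond_dvd j Fs; case: Fs => sN s_gt0 _.
split=> [j|]; first by rewrite ffunE divn_gt0 ?m_gt0 // dvdn_leq.
by rewrite -sN total_margB; apply: eq_bigr => j _; rewrite ffunE mulnC divnK.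
Qed.

Hypothesis c_sum1 : forall j, (\sum_(i : level n A) c i j = 1)%R.

Let natr_inj := @mulrIn _ _ (@oner_neq0 rat).

Lemma sum_sol_margin x j : \sum_i sol_margin m c x i j = m j * x j.
Proof.
apply: natr_inj; rewrite natr_sum natrM.
under eq_bigr do rewrite sol_marginE.
by rewrite -mulr_sumr c_sum1 mulr1.
Qed.

Lemma F_cond_fiber x : possols m N x ->
  [set s | F_cond N c s /\ solution_of s = x]%classic
  = F_marg (sol_margin m c x).
Proof.
move=> [x_gt0 xN]; apply/seteqP; split=> [s [Fs <-] i j|s sx].
  have mB := F_cond_dvd j Fs; case: Fs => _ s_gt0 sc.
  apply: natr_inj; rewrite sol_marginE ffunE -natrM mulnC divnK // -sc mulrC.
  by rewrite divfK // pnatr_eq0 -lt0n.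
have sB j : margB A s j = m j * x j.
  by rewrite -sum_sol_margin; apply: eq_bigr => i _; rewrite -sx.
split; last by apply/ffunP=> j; rewrite ffunE sB mulKn // m_gt0.
split=> [|j|i j]; first by rewrite total_margB -xN; apply: eq_bigr.
  by rewrite sB muln_gt0 m_gt0 x_gt0.
have mx : ((m j)%:R * (x j)%:R != 0 :> rat)%R.
  by rewrite mulf_neq0 // pnatr_eq0 -lt0n ?m_gt0.
by rewrite sx sol_marginE sB natrM mulrAC mulfV // mul1r.
Qed.

End Conditionals.

Theorem corollary2p6 (r : nat) (n : 'I_r -> nat)
    (n_gt0 : forall v, 0 < n v)
    (A B : {set 'I_r})
    (A_proper : A \proper [set: 'I_r]%SET)
    (B_proper : B \proper [set: 'I_r]%SET)
    (AB_disjoint : [disjoint A & B])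
    (N : nat) (N_gt0 : 0 < N)
    (g h : level n A -> level n B -> nat)
    (h_gt0 : forall i j, 0 < h i j)
    (gh_coprime : forall i j, coprime (g i j) (h i j))
    (c : level n A -> level n B -> rat)
    (c_def : forall i j, c i j = ((g i j)%:R / (h i j)%:R)%R)
    (c_sum1 : forall j, (\sum_(i : level n A) c i j = 1)%R)
    (m : level n B -> nat)
    (m_def : forall j, m j = \big[lcmn/1]_(i : level n A) h i j)
    (K : nat) (K_def : K = #|level n (rest A B)|) :
  let sols : set {ffun level n B -> nat} := possols m N in
  let p := sol_margin m c in
  [/\ finite_set sols,
      finite_set (F_cond N c),
      ncard (F_cond N c) = \big[addn/0]_(x \in sols) ncard (F_marg (p x)) &
      forall x, sols x ->
        [/\ forall i j, ((p x i j)%:R = (m j)%:R * (x j)%:R * c i j :> rat)%R,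
            finite_set (F_marg (p x)) &
            ncard (F_marg (p x)) =
              \prod_(i : level n A) \prod_(j : level n B)
                 'C(p x i j + K - 1, K - 1)]].
Proof.
move=> sols p; have finD : finite_set sols := finite_possols N h_gt0 m_def.
have finF := finite_F_cond N c.
split=> // [|x _].
  rewrite (ncard_fibers (f := @solution_of r n A B m) finF finD).
    apply: eq_fsbigr => x /set_mem Dx.
    by rewrite (F_cond_fiber h_gt0 m_def c_def gh_coprime c_sum1 Dx).
  by move=> s; apply: (solution_of_possols h_gt0 m_def c_def).
split; first by move=> i j; apply: (sol_marginE h_gt0 m_def c_def).
  exact: finite_F_marg.
by rewrite K_def ncard_F_marg // level_gt0.
Qed.
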